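(* Let $\tau>0$, $a\ge2$, let $s,d$ be integers with $1\le s\le d$ and let $\ell\in\mathcal L$. Then $$\inf_{\hat T}\sup_{P_\xi\in\mathcal P_{a,\tau}}\sup_{\sigma>0}\sup_{\theta\in\Theta_s}\mathbf E_{\theta,P_\xi,\sigma}\,\ell\Big(c\,\phi_{\rm pol}(s,d)^{-1}\Big|\frac{\hat T}{\sigma^2}-1\Big|\Big)\ge c',$$ where $\phi_{\rm pol}(s,d)=\max\big(\frac1{\sqrt d},(\frac sd)^{1-\frac2a}\big)$ and $c,c'>0$ depend only on $\ell$, $a$ and $\tau$.
   Context: Model: $Y_i=\theta_i+\sigma\xi_i$, $i=1,\dots,d$, $\theta\in\mathbb R^d$, $\sigma>0$, $\xi_i$ i.i.d. with distribution $P_\xi$; $\mathbf E_{\theta,P_\xi,\sigma}$ expectation; $\Theta_s=\{\theta:\|\theta\|_0\le s\}$. For $\tau>0,a\ge2$, $\mathcal P_{a,\tau}$: distributions with $\mathbf E\xi_1=0,\mathbf E\xi_1^2=1$, $\mathbf P(|\xi_1|>t)\le(\tau/t)^a$ for all $t\ge2$. $\mathcal L$: nondecreasing $\ell:[0,\infty)\to[0,\infty)$, $\ell(0)=0$, $\ell\not\equiv0$; $\inf_{\hat T}$ over all estimators. *)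

(* Defs.v *)
From HB Require Import structures.
From mathcomp Require Import all_boot all_order all_algebra.
From mathcomp Require Import all_classical all_reals all_analysis.
Set Implicit Arguments. Unset Strict Implicit. Unset Printing Implicit Defensive.
Import Order.TTheory GRing.Theory Num.Theory.
Local Open Scope classical_set_scope.
Local Open Scope ring_scope.

Section defs.
Variable R : realType.

Definition loss_class (l : R -> R) : Prop :=
  [/\ forall x y, 0 <= x -> x <= y -> l x <= l y,
      l 0 = 0,
      forall x, 0 <= x -> 0 <= l x &
      exists x, 0 <= x /\ l x != 0].

Definition noise_class (a tau : R) (P : probability R R) : Prop :=
  [/\ P.-integrable [set: R] (fun x => x%:E),
      (\int[P]_x x%:E = 0)%E,
      (\int[P]_x (x ^+ 2)%:E = 1)%E &
      forall t : R, 2 <= t -> (P [set x | (t < `|x|)%R] <= ((tau / t) `^ a)%:E)%E].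

(** Expectation of a function of n i.i.d. coordinates with law P, written as
    an iterated integral against P^{(x) n} (equal to the integral against the
    n-fold product measure by Tonelli, the integrands below being nonnegative
    and measurable). *)
Fixpoint iid_expect (P : probability R R) (n : nat) :
    (n.-tuple R -> \bar R) -> \bar R :=
  match n return (n.-tuple R -> \bar R) -> \bar R with
  | 0 => fun f => f [tuple]
  | n'.+1 => fun f => (\int[P]_x iid_expect P (fun t => f (cons_tuple x t)))%E
  end.

Definition sparse (s d : nat) (theta : d.-tuple R) : Prop :=
  (count (fun x : R => x != 0%R) theta <= s)%N.

Definition observe (d : nat) (theta : d.-tuple R) (sigma : R)
    (xi : d.-tuple R) : d.-tuple R :=
  [tuple tnth theta i + sigma * tnth xi i | i < d].

Definition phi_pol (a : R) (s d : nat) : R :=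
  Num.max (Num.sqrt d%:R)^-1 ((s%:R / d%:R) `^ (1 - 2 / a)).

Definition risk (l : R -> R) (c : R) (a : R) (s d : nat)
    (T : d.-tuple R -> R) (P : probability R R) (sigma : R)
    (theta : d.-tuple R) : \bar R :=
  iid_expect P (fun xi =>
    (l (c * (phi_pol a s d)^-1 * `|T (observe theta sigma xi) / sigma ^+ 2 - 1|))%:E).

Definition minimax_risk (l : R -> R) (c a tau : R) (s d : nat) : \bar R :=
  ereal_inf [set r | exists T : d.-tuple R -> R,
    measurable_fun [set: d.-tuple R] T /\
    r = ereal_sup [set v | exists (P : probability R R) (sigma : R)
                              (theta : d.-tuple R),
       [/\ noise_class a tau P, 0 < sigma, sparse s theta &
           v = risk l c a s T P sigma theta]]].
End defs.

(* Main.v *)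
(* All noises are finitely supported: Y_i = eta_i + U_i with U_i a random sign
   and eta_i a random-signed outlier of size t present with probability q, so
   that sigma^2 = 1 + q t^2.

   Rate 1/sqrt d: take t = 1 and compare q = 1/2 with q = 1/2 + c/sqrt d. The
   likelihood ratio L of the two d-samples has bounded second moment, and
   min(1, L) >= L - L^2/4, so no estimator is accurate under both.

   Rate (s/d)^(1 - 2/a): take q = s/(4d) and t of order tau q^(-1/a), the
   largest size allowed by the tail condition, so that q t^2 is of order
   (s/d)^(1 - 2/a). The outliers may belong to the noise (theta = 0,
   sigma^2 = 1 + q t^2) or to a random theta (noise U, sigma^2 = 1); the law of
   Y is the same. By Markov's inequality theta is s-sparse with probability at
   least 3/4. *)

Require Import Defs.
From HB Require Import structures.
From mathcomp Require Import all_boot all_order all_algebra.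
From mathcomp Require Import all_classical all_reals all_analysis.
From mathcomp Require Import measurable_realfun ring lra.
Import Order.TTheory GRing.Theory Num.Theory.
Local Open Scope ring_scope.

(** * Finitely supported laws and their integrals *)

Lemma measurable_fun_finite_set (R : realType) d (T : measurableType d)
    (D : set R) (f : R -> T) :
  finite_set D -> measurable_fun D f.
Proof.
move=> finD mD Y mY; apply: countable_measurable.
  by move=> t; exact: measurable_set1.
by apply: finite_set_countable; apply: sub_finite_set finD; exact: subIsetl.
Qed.

(* No measurability is needed, since the integral of a nonnegative function is a
   supremum over the simple functions below it. *)
Lemma ge0_le_integralT (R : realType) d (T : measurableType d)
    (mu : {measure set T -> \bar R}) (f g : T -> \bar R) :
  (forall x, 0 <= f x)%E -> (forall x, f x <= g x)%E ->
  (\int[mu]_x f x <= \int[mu]_x g x)%E.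
Proof.
move=> f0 fg; rewrite !ge0_integralTE//; last first.
  by move=> x; exact: le_trans (f0 x) (fg x).
apply: le_ereal_sup => _ [h /= hf <-]; exists h => //= x.
exact: le_trans (hf x) (fg x).
Qed.

(** The law is a finite sum of scaled Dirac masses at the points [x i]. *)
Lemma discrete_probability (R : realType) (I : finType) (w x : I -> R) :
  (forall i, 0 <= w i) -> \sum_i w i = 1 ->
  exists P : probability R R, forall f : R -> \bar R,
    measurable_fun setT f -> (forall y, 0 <= f y)%E ->
    (\int[P]_y f y = \sum_i (w i)%:E * f (x i))%E.
Proof.
move=> w0 w1; pose p := [seq (w i, x i) | i <- enum I].
have sumpE (F : R * R -> \bar R) :
    (\sum_i F (w i, x i) = \sum_(k < size p) F (nth (0%R, 0%R) p k))%E.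
  by rewrite -big_enum -(big_map (fun i => (w i, x i)) xpredT F) -/p
     (big_nth (0%R, 0%R)) big_mkord.
(* [msum] is indexed by naturals, hence the list [p]; only indices below [size p] are summed, so the
   default pair never contributes. *)
pose m (k : nat) : {measure set R -> \bar R} :=
  mscale (NngNum (normr_ge0 (nth (0, 0) p k).1)) (dirac (nth (0, 0) p k).2).
have intE (f : R -> \bar R) : measurable_fun setT f -> (forall y, 0 <= f y)%E ->
    (\int[msum m (size p)]_y f y = \sum_i (w i)%:E * f (x i))%E.
  move=> mf f0; rewrite ge0_integral_measure_sum//.
  rewrite (eq_bigr (fun i => `|w i|%:E * f (x i))%E); last first.
    by move=> i _; rewrite ger0_norm.
  rewrite (sumpE (fun z => `|z.1|%:E * f z.2)%E).
  apply: eq_bigr => k _; rewrite ge0_integral_mscale//= integral_dirac//.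
  by rewrite diracT mul1e.
have mT : msum m (size p) setT = 1%E.
  rewrite -(mul1e (msum _ _ _)) -integral_cst// intE//.
  under eq_bigr do rewrite mule1.
  by rewrite sumEFin w1.
pose isP := Measure_isProbability.Build _ _ _ (msum m (size p)) mT.
pose P : probability R R := HB.pack (Measure.sort (msum m (size p))) isP.
by exists P => f mf f0; rewrite -intE.
Qed.

(** * Finite iterated expectations *)

(** The recursion copies that of [iid_expect], so that the two compare by induction on [n]. *)
Fixpoint fin_expect {R : realType} {I : finType} (w : I -> R) {n : nat} :
    (n.-tuple I -> R) -> R :=
  match n return (n.-tuple I -> R) -> R with
  | 0 => fun F => F [tuple]
  | n'.+1 => fun F =>
      \sum_i w i * fin_expect w (fun t => F (cons_tuple i t))
  end.

Section fin_expect_theory.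
Context {R : realType} {I : finType}.
Implicit Types w : I -> R.

Lemma eq_fin_expect w n (F G : n.-tuple I -> R) :
  F =1 G -> fin_expect w F = fin_expect w G.
Proof.
elim: n F G => [|n IH] F G FG; first exact: FG.
by apply: eq_bigr => i _; congr (_ * _); apply: IH => t; exact: FG.
Qed.

Lemma fin_expect_le w n (F G : n.-tuple I -> R) : (forall i, 0 <= w i) ->
  (forall t, F t <= G t) -> fin_expect w F <= fin_expect w G.
Proof.
move=> w0; elim: n F G => [|n IH] F G FG; first exact: FG.
by apply: ler_sum => i _; apply: ler_wpM2l => //; apply: IH => t; exact: FG.
Qed.

Lemma fin_expectD w n (F G : n.-tuple I -> R) :
  fin_expect w (fun t => F t + G t) = fin_expect w F + fin_expect w G.
Proof.
elim: n F G => [//|n IH] F G /=.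
by rewrite -big_split; apply: eq_bigr => i _; rewrite IH mulrDr.
Qed.

Lemma fin_expectZ w n k (F : n.-tuple I -> R) :
  fin_expect w (fun t => k * F t) = k * fin_expect w F.
Proof.
elim: n F => [//|n IH] F /=.
by rewrite big_distrr; apply: eq_bigr => i _; rewrite IH mulrCA.
Qed.

Lemma fin_expect_cst w n k : \sum_i w i = 1 ->
  fin_expect w (fun _ : n.-tuple I => k) = k.
Proof.
by move=> w1; elim: n => [//|n IH] /=; rewrite IH -big_distrl /= w1 mul1r.
Qed.

Lemma fin_expect_ge0 w n (F : n.-tuple I -> R) : (forall i, 0 <= w i) ->
  (forall t, 0 <= F t) -> 0 <= fin_expect w F.
Proof.
move=> w0; elim: n F => [|n IH] F F0; first exact: F0.
by apply: sumr_ge0 => i _; rewrite mulr_ge0//; apply: IH.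
Qed.

Lemma fin_expect_sum w n (J : finType) (c : J -> R)
    (F : J -> n.-tuple I -> R) :
  fin_expect w (fun t => \sum_j c j * F j t) =
  \sum_j c j * fin_expect w (F j).
Proof.
elim: n F => [//|n IH] F /=.
under eq_bigr do rewrite IH big_distrr /=.
rewrite exchange_big /=; apply: eq_bigr => j _.
by rewrite big_distrr; apply: eq_bigr => i _; rewrite mulrCA.
Qed.

(** Change of measure: the likelihood ratio of two i.i.d. samples is the product of the coordinate
    ratios [h]. *)
Lemma fin_expect_reweight w (h : I -> R) n (F : n.-tuple I -> R) :
  fin_expect (fun i => w i * h i) F =
  fin_expect w (fun t => (\prod_(i <- t) h i) * F t).
Proof.
elim: n F => [|n IH] F; first by rewrite /= big_nil mul1r.
rewrite /=; apply: eq_bigr => i _; rewrite -mulrA IH -fin_expectZ.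
congr (_ * _).
by apply: eq_fin_expect => t; rewrite big_cons mulrA.
Qed.

Lemma fin_expect_prod w (h : I -> R) n :
  fin_expect w (fun t : n.-tuple I => \prod_(i <- t) h i) =
  (\sum_i w i * h i) ^+ n.
Proof.
elim: n => [|n IH]; first by rewrite /= big_nil.
rewrite exprS -IH big_distrl /=; apply: eq_bigr => i _.
rewrite -mulrA -(fin_expectZ _ _ (h i)); congr (_ * _).
by apply: eq_fin_expect => t; rewrite big_cons.
Qed.

Lemma fin_expect_count w (p : pred I) n : \sum_i w i = 1 ->
  fin_expect w (fun t : n.-tuple I => (count p t)%:R) =
  n%:R * \sum_(i | p i) w i.
Proof.
move=> w1; elim: n => [|n IH]; first by rewrite /= mul0r.
rewrite /=; under eq_bigr.
  move=> i _; rewrite (@eq_fin_expect _ _ _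
    (fun t => (p i)%:R + (count p t)%:R)).
    rewrite fin_expectD fin_expect_cst// IH; over.
  by move=> t; rewrite natrD.
under eq_bigr do rewrite mulrDr.
rewrite big_split /= -big_distrl /= w1 mul1r -natr1 mulrDl mul1r addrC.
congr (_ + _); rewrite [RHS]big_mkcond; apply: eq_bigr => i _.
by case: (p i); rewrite ?mulr1 ?mulr0.
Qed.

End fin_expect_theory.

(** Fubini for two independent samples: it merges a random mean and the sign noise into one sample
    of pairs. *)
Lemma fin_expect_pair (R : realType) (I J : finType) (w : I -> R) (v : J -> R)
    n (F : n.-tuple I -> n.-tuple J -> R) :
  fin_expect w (fun s => fin_expect v (F s)) =
  fin_expect (fun ij : I * J => w ij.1 * v ij.2)
    (fun t => F (map_tuple fst t) (map_tuple snd t)).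
Proof.
elim: n F => [|n IH] F /=; first by congr F; apply: val_inj.
transitivity (\sum_i \sum_j w i * v j *
    fin_expect (fun ij : I * J => w ij.1 * v ij.2) (fun t =>
      F (map_tuple fst (cons_tuple (i, j) t))
        (map_tuple snd (cons_tuple (i, j) t)))); last first.
  by rewrite pair_bigA; apply: eq_bigr => -[i j] _.
apply: eq_bigr => i _; rewrite fin_expect_sum big_distrr /=.
apply: eq_bigr => j _; rewrite mulrA; congr (_ * _).
rewrite IH; apply: eq_fin_expect => t.
by congr F; apply: val_inj.
Qed.

(** * Comparison with [iid_expect], [noise_class] and [risk] *)

(** A lower bound on the risk uses only this inequality. The inner integral may fail to be
    measurable in the first coordinate, so it is bounded below by a function vanishing off the
    finite set [range x], which is measurable and integrates to a finite sum. *)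
Lemma discrete_iid_expect_ge {R : realType} {I : finType} (w x : I -> R)
    (P : probability R R) :
  (forall i, 0 <= w i) ->
  (forall f : R -> \bar R, measurable_fun setT f -> (forall y, 0 <= f y)%E ->
    (\int[P]_y f y = \sum_i (w i)%:E * f (x i))%E) ->
  forall n (F : n.-tuple R -> R), (forall y, 0 <= F y) ->
  ((fin_expect w (fun t => F (map_tuple x t)))%:E <=
   iid_expect P (fun y => (F y)%:E))%E.
Proof.
move=> w0 intP; elim=> [|n IH] F F0.
  by rewrite /= (_ : map_tuple x [tuple] = [tuple])//; exact: val_inj.
pose G y := fin_expect w (fun t => F (cons_tuple y (map_tuple x t))).
have G0 y : 0 <= G y by exact: fin_expect_ge0.
have finX : finite_set (range x) by exact: finite_image.
rewrite /=; apply: (@le_trans _ _ (\int[P]_y ((EFin \o G) \_ (range x)) y)%E).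
  rewrite intP.
  - rewrite -sumEFin; apply: lee_sum => i _.
    rewrite patchE mem_set; last by exists i.
    rewrite /= lee_fin ler_wpM2l//; apply: fin_expect_le => // t.
    rewrite le_eqVlt; apply/orP; left; apply/eqP; congr F; exact: val_inj.
  - apply/(measurable_restrictT _ _).1; last exact: measurable_fun_finite_set.
    by apply: countable_measurable => //; exact: finite_set_countable.
  - by move=> y; apply: erestrict_ge0 => z _; rewrite lee_fin.
apply: ge0_le_integralT => y.
  by apply: erestrict_ge0 => z _; rewrite lee_fin.
apply: le_trans (IH (fun t => F (cons_tuple y t)) (fun t => F0 _)).
rewrite patchE; case: ifP => _ /=; first exact: lexx.
by rewrite lee_fin; exact: G0.
Qed.

Lemma discrete_noise_class {R : realType} {I : finType} (a tau : R)
    (w x : I -> R) (P : probability R R) :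
  (forall f : R -> \bar R, measurable_fun setT f -> (forall y, 0 <= f y)%E ->
    (\int[P]_y f y = \sum_i (w i)%:E * f (x i))%E) ->
  \sum_i w i * x i = 0 -> \sum_i w i * x i ^+ 2 = 1 ->
  (forall t : R, 2 <= t -> \sum_(i | t < `|x i|) w i <= (tau / t) `^ a) ->
  noise_class a tau P.
Proof.
move=> intP mean0 var1 tail.
have mid : measurable_fun setT (fun y : R => y%:E) by exact: EFin_measurable.
have int_fin (g : R -> R) : measurable_fun setT g -> (forall y, 0 <= g y) ->
    (\int[P]_y (g y)%:E = (\sum_i w i * g (x i))%:E)%E.
  move=> mg g0; rewrite intP//; last exact/measurable_EFinP.
  by rewrite -sumEFin; apply: eq_bigr => i _; rewrite EFinM.
have int_abs : (\int[P]_y `|y%:E| = (\sum_i w i * `|x i|)%:E)%E.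
  by rewrite -int_fin//; exact: normr_measurable.
split.
- by apply/integrableP; split => //; rewrite int_abs ltry.
(* [intP] covers nonnegative functions only, hence the split into positive and negative parts. *)
- rewrite integralE.
  rewrite (eq_integral (fun y : R => (Num.max y 0)%:E)); last first.
    by move=> y _; rewrite funeposE EFin_max.
  rewrite [X in (_ - X)%E](eq_integral
      (fun y : R => (Num.max (- y) 0)%:E)); last first.
    by move=> y _; rewrite funenegE EFin_max.
  rewrite !int_fin//.
  + rewrite -EFinB -sumrB; congr EFin; rewrite -[RHS]mean0.
    apply: eq_bigr => i _.
    rewrite -mulrBr; congr (_ * _).
    by rewrite !maxElt; case: ltP => ?; case: ltP => ?; lra.
  + by apply: measurable_maxr => //; exact: measurableT_comp.
  + by move=> y; rewrite le_max lexx orbT.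
  + exact: measurable_maxr.
  + by move=> y; rewrite le_max lexx orbT.
- by rewrite int_fin ?var1// => y; exact: sqr_ge0.
- move=> t t2; set A := (X in P X).
  have mA : measurable A.
    rewrite (_ : A = (@Num.norm R R @^-1` [set` `]t, +oo[%R])%classic).
      by rewrite -[X in measurable X]setTI; exact: normr_measurable.
    by apply/seteqP; split => y; rewrite /A /= in_itv /= andbT.
  rewrite -(setIT A) -integral_indic// int_fin//.
  rewrite lee_fin; apply: le_trans (tail t t2); rewrite [leRHS]big_mkcond.
  apply: ler_sum => i _; rewrite indicE; case: ifP => [h|h].
    by rewrite mem_set ?mulr1.
  by rewrite memNset ?mulr0// /A /= h.
Qed.

(* The noise of law in [noise_class] is [xi = z / sigma]; it is [sigma * xi]
   that takes the values [z i], so tails are measured in units of [sigma]. *)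
Definition scaled_noise {R : realType} {I : finType} (a tau : R)
    (w z : I -> R) (sigma : R) : Prop :=
  [/\ forall i, 0 <= w i, \sum_i w i = 1, \sum_i w i * z i = 0,
      \sum_i w i * z i ^+ 2 = sigma ^+ 2 &
      forall t : R, 2 <= t ->
        \sum_(i | t * sigma < `|z i|) w i <= (tau / t) `^ a].

(** [P] is the law of [z i / sigma], so multiplying by [sigma] in [observe] restores the values
    [z i]. *)
Lemma scaled_noise_risk {R : realType} {I : finType} (l : R -> R) (c a tau : R)
    (s d : nat) (w z : I -> R) (sigma : R) (T : d.-tuple R -> R) :
  (forall y, 0 <= y -> 0 <= l y) -> 0 <= c ->
  0 < sigma -> scaled_noise a tau w z sigma ->
  exists2 P : probability R R, noise_class a tau P & forall theta,
  ((fin_expect w (fun t => l (c * (phi_pol a s d)^-1 *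
      `|T [tuple tnth theta i + z (tnth t i) | i < d] / sigma ^+ 2 - 1|)))%:E
    <= risk l c a s T P sigma theta)%E.
Proof.
move=> l0 c0 sg0 [w0 w1 mean0 var tail].
have sgN0 : sigma != 0 by rewrite gt_eqF.
have [P intP] := @discrete_probability _ _ w (fun i => z i / sigma) w0 w1.
exists P; [apply: discrete_noise_class intP _ _ _|move=> theta].
- under eq_bigr do rewrite mulrA.
  by rewrite -big_distrl /= mean0 mul0r.
- under eq_bigr do rewrite expr_div_n mulrA.
  by rewrite -big_distrl /= var divff// expf_neq0.
- move=> t t2; rewrite (eq_bigl (fun i => t * sigma < `|z i|)).
    exact: tail.
  by move=> i; rewrite normrM normfV (gtr0_norm sg0) ltr_pdivlMr.
apply: le_trans (discrete_iid_expect_ge _ _ _ w0 intP _ _ _); last first.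
  move=> y; apply: l0; rewrite !mulr_ge0// invr_ge0 /phi_pol le_max.
  by rewrite powR_ge0 orbT.
rewrite lee_fin; apply: fin_expect_le => // t.
rewrite le_eqVlt; apply/orP; left.
rewrite (_ : [tuple _ | _ < _] = observe theta sigma
  (map_tuple (fun i => z i / sigma) t))//.
by apply: eq_from_tnth => i; rewrite !tnth_mktuple tnth_map mulrCA divff ?mulr1.
Qed.

Lemma lte_EFin_exists_le {R : realType} (S : \bar R) (c : R) :
  (S < c%:E)%E -> exists2 M : R, (S <= M%:E)%E & M < c.
Proof.
case: S => [r| |]//; first by rewrite lte_fin => rc; exists r.
by move=> _; exists (c - 1); [rewrite leNye|lra].
Qed.

(** * Sign noise contaminated by outliers *)

Definition sgb {R : realType} (b : bool) : R := if b then 1 else -1.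

Definition coin {R : realType} (b : bool) : R := 2^-1.

(* An index [(b, e)] stands for an outlier of size [t] and sign [e], present
   exactly when [b] holds, which has probability [q]. *)
Definition outlier {R : realType} (t : R) (i : bool * bool) : R :=
  if i.1 then t * sgb i.2 else 0.

Definition outlier_prob {R : realType} (q : R) (i : bool * bool) : R :=
  (if i.1 then q else 1 - q) * coin i.2.

Definition contaminated {R : realType} (t : R) (i : bool * bool * bool) : R :=
  outlier t i.1 + sgb i.2.

Definition contaminated_prob {R : realType} (q : R) (i : bool * bool * bool) :=
  outlier_prob q i.1 * coin i.2.

Lemma sum_bool2 {R : realType} (F : bool * bool -> R) :
  \sum_i F i = F (true, true) + F (true, false) +
               (F (false, true) + F (false, false)).
Proof.
transitivity (\sum_b \sum_e F (b, e)); last by rewrite !big_bool.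
by rewrite pair_bigA; apply: eq_bigr => -[].
Qed.

Lemma sum_bool3 {R : realType} (F : bool * bool * bool -> R) :
  \sum_i F i = \sum_i (F (i, true) + F (i, false)).
Proof.
transitivity (\sum_i \sum_u F (i, u)).
  by rewrite pair_bigA; apply: eq_bigr => -[].
by apply: eq_bigr => i _; rewrite big_bool.
Qed.

Lemma sum_outlier_prob {R : realType} (q : R) : \sum_i outlier_prob q i = 1.
Proof. by rewrite sum_bool2 /outlier_prob /coin /=; lra. Qed.

Lemma sum_contaminated_prob {R : realType} (q : R) :
  \sum_i contaminated_prob q i = 1.
Proof.
rewrite sum_bool3 sum_bool2 /contaminated_prob /outlier_prob /coin /=; lra.
Qed.

Lemma contaminated_prob_ge0 {R : realType} (q : R) i : 0 <= q <= 1 ->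
  0 <= contaminated_prob q i.
Proof.
move=> /andP[q0 q1]; rewrite !mulr_ge0 ?invr_ge0//.
by case: ifP => // _; rewrite subr_ge0.
Qed.

(** Since [sigma >= 1], tail levels are at least 2, while the noise has modulus 1 without an
    outlier: the tail is at most [q]. It vanishes from level [1 + t] on, so the bound on [q] at that
    level covers all smaller ones; for [t <= 1] the tail is empty. *)
Lemma contaminated_noise {R : realType} (a tau q t sigma : R) :
  0 < tau -> 0 <= a -> 0 <= q <= 1 -> 0 <= t ->
  (1 < t -> q <= (tau / (1 + t)) `^ a) ->
  0 < sigma -> sigma ^+ 2 = 1 + q * t ^+ 2 ->
  scaled_noise a tau (contaminated_prob q) (contaminated t) sigma.
Proof.
move=> tau0 a0 q01 t0 qt sg0 sgE.
have [q0 q1] := andP q01.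
have sg1 : 1 <= sigma.
  have : 1 <= sigma ^+ 2 by rewrite sgE lerDl mulr_ge0// sqr_ge0.
  by rewrite -[X in X <= _](expr1n _ 2) ler_pXn2r// nnegrE ltW.
have z1 (i : bool * bool * bool) : ~~ i.1.1 -> `|contaminated t i| = 1.
  case: i => -[b e] u /= /negbTE bF; rewrite /contaminated /outlier /= bF add0r.
  by rewrite /sgb; case: u; rewrite ?normrN normr1.
have zt i : `|contaminated t i| <= 1 + t.
  have [i1|i1] := boolP i.1.1; last by rewrite z1//; lra.
  rewrite /contaminated /outlier i1 addrC (le_trans (ler_normD _ _))//.
  rewrite normrM (ger0_norm t0) /sgb.
  by case: i.2; case: i.1.2; rewrite ?normrN normr1 mulr1.
split.
- by move=> i; exact: contaminated_prob_ge0.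
- exact: sum_contaminated_prob.
- rewrite sum_bool3 sum_bool2 /contaminated_prob /contaminated.
  by rewrite /outlier_prob /outlier /coin /sgb /=; lra.
- rewrite sum_bool3 sum_bool2 /contaminated_prob /contaminated sgE.
  by rewrite /outlier_prob /outlier /coin /sgb /=; field.
- move=> x x2.
  have xs : 2 <= x * sigma by rewrite (le_trans x2)// ler_peMr//; lra.
  have [xt|xt] := ltP (x * sigma) (1 + t); last first.
    rewrite big_pred0 ?powR_ge0// => i.
    by apply/negbTE; rewrite -leNgt (le_trans (zt i)).
  have xlet : x <= 1 + t.
    by apply: le_trans (ltW xt); rewrite ler_peMr//; lra.
  apply: (@le_trans _ _ q); last first.
    apply: (le_trans (qt _)); first lra.
    apply: ge0_ler_powR => //; rewrite ?nnegrE ?divr_ge0//; try lra.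
    by rewrite ler_pM2l// lef_pV2 ?posrE; lra.
  rewrite big_mkcond /=.
  apply: (@le_trans _ _ (\sum_i contaminated_prob q i * (i.1.1)%:R)).
    apply: ler_sum => i _; have p0 := contaminated_prob_ge0 q i q01.
    case: ifP => [h|_]; last by rewrite mulr_ge0.
    have [i1|i1] := boolP i.1.1; first by rewrite mulr1.
    by move: h; rewrite z1//; lra.
  rewrite sum_bool3 sum_bool2 /contaminated_prob /outlier_prob /coin /=; lra.
Qed.

Lemma rademacher_noise {R : realType} (a tau : R) :
  scaled_noise a tau coin sgb 1.
Proof.
split.
- by move=> i; rewrite invr_ge0.
- by rewrite big_bool /coin /=; lra.
- by rewrite big_bool /coin /sgb /=; lra.
- by rewrite big_bool /coin /sgb /=; field.
- move=> t t2; rewrite big_pred0 ?powR_ge0// => u.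
  by apply/negbTE; rewrite -leNgt /sgb; case: u; rewrite ?normrN normr1; lra.
Qed.

(** * Separation of variances and choice of the outlier size *)

(** If both failed, [(1 - rho) * v1 < y < (1 + rho) * v0], which contradicts the separation. *)
Lemma variances_separated {R : realType} (rho v0 v1 y : R) :
  0 < v0 -> 0 < v1 -> rho * (v0 + v1) <= v1 - v0 ->
  (rho <= `|y / v0 - 1|) || (rho <= `|y / v1 - 1|).
Proof.
move=> v00 v10 sep; apply/norP => -[]; rewrite -!ltNge !ltr_norml.
move=> /andP[_]; rewrite ltrBlDr ltr_pdivrMr// => y0.
move=> /andP[+ _]; rewrite ltrBrDr ltr_pdivlMr// => y1.
nra.
Qed.

(** Division-free form of [(1 + x) ^+ n <= 1 / (1 - n x)]; it bounds the second moment of the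
    likelihood ratio. *)
Lemma exprD1_bernoulli_le {R : realType} (x : R) n :
  0 <= x -> (1 + x) ^+ n * (1 - n%:R * x) <= 1.
Proof.
move=> x0; elim: n => [|n IH]; first by rewrite expr0; lra.
apply: le_trans IH; rewrite exprSr -mulrA ler_wpM2l//.
  by rewrite exprn_ge0//; lra.
rewrite -natr1; have n0 : 0 <= n%:R :> R by [].
have -> : (1 + x) * (1 - (n%:R + 1) * x) =
  1 - n%:R * x - (n%:R + 1) * x ^+ 2 by ring.
by rewrite gerBl mulr_ge0 ?sqr_ge0//; lra.
Qed.

Lemma outlier_size {R : realType} (a tau q : R) : 0 < tau -> 2 <= a ->
  0 < q -> q <= 4^-1 ->
  exists t, [/\ 0 <= t, 1 < t -> q <= (tau / (1 + t)) `^ a &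
    tau ^+ 2 / 16 * (4 * q) `^ (1 - 2 / a) <= q * t ^+ 2].
Proof.
move=> tau0 a2 q0 q4; have a0 : 0 < a by lra.
pose r := q `^ a^-1; have r0 : 0 < r by exact: powR_gt0.
have ra : r `^ a = q by rewrite /r -powRrM mulVf ?gt_eqF// powRr1// ltW.
pose k := tau / r; have k0 : 0 < k by rewrite divr_gt0.
have qe : q `^ (1 - 2 / a) * r ^+ 2 = q.
  rewrite -powR_mulrn ?ltW// /r -powRrM -powRD; last first.
    by apply/implyP => _; rewrite gt_eqF.
  have -> : 1 - 2 / a + a^-1 * 2 = 1 by field; lra.
  by rewrite powRr1// ltW.
have main : tau ^+ 2 / 16 * (4 * q) `^ (1 - 2 / a) <= q * (k ^+ 2 / 4).
  have -> : q * (k ^+ 2 / 4) = tau ^+ 2 / 16 * (4 * q `^ (1 - 2 / a)).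
    by rewrite -[in LHS]qe /k; field; lra.
  rewrite ler_wpM2l ?divr_ge0 ?sqr_ge0// powRM ?(ltW q0)//.
  rewrite ler_wpM2r ?powR_ge0// -[leRHS]powRr1// ler_powR ?ler1n//.
  by rewrite gerBl divr_ge0// ltW.
(* Both choices give [t >= k / 2]: [t = 1] when [k <= 2], where the tail condition is void, and
   [t = k - 1] otherwise. *)
have [k2|k2] := leP k 2.
  exists 1; split; [lra|lra|].
  by apply: le_trans main _; rewrite ler_pM2l//; nra.
exists (k - 1); split; [lra| |].
  by move=> _; rewrite addrC subrK /k invf_div mulrCA divff ?mulr1 ?ra// gt_eqF.
by apply: le_trans main _; rewrite ler_pM2l//; nra.
Qed.

(* [M] dominates [k] times the probability that [T / sigma ^ 2] misses [1] by
   at least [rho], for every finitely supported noise and every sparse mean. *)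
Definition miss_bound {R : realType} (a tau : R) (s : nat) {d : nat}
    (T : d.-tuple R -> R) (rho k M : R) : Prop :=
  forall (I : finType) (w z : I -> R) (sigma : R), 0 < sigma ->
    scaled_noise a tau w z sigma ->
  forall theta : d.-tuple R, sparse s theta ->
  k * fin_expect w (fun t => (rho <=
    `|T [tuple tnth theta i + z (tnth t i) | i < d] / sigma ^+ 2 - 1|)%R%:R)
    <= M.

(** * Lower bounds at the two rates *)

Lemma sparse0 {R : realType} s d : sparse s [tuple (0 : R) | _ < d].
Proof.
rewrite /sparse (@eq_in_count _ _ pred0) ?count_pred0//.
by move=> x /mapP[i _ ->]; rewrite eqxx.
Qed.

Lemma parametric_bound {R : realType} (a tau : R) (s d : nat)
    (T : d.-tuple R -> R) (rho k M : R) :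
  0 < tau -> 0 <= a -> (0 < d)%N -> 0 <= k -> rho <= (16 * Num.sqrt d%:R)^-1 ->
  miss_bound a tau s T rho k M -> k / 4 <= M.
Proof.
move=> tau0 a0 d0 k0 rho_le HM.
have dR : 1 <= d%:R :> R by rewrite ler1n.
pose D := Num.sqrt (d%:R : R).
have D2 : D ^+ 2 = d%:R by rewrite sqr_sqrtr.
have D1 : 1 <= D by rewrite -sqrtr1 ler_wsqrtr.
(* Scaled so that [d * e ^+ 2 = 1/4], which keeps the second moment [(1 + e ^+ 2) ^+ d] of the
   likelihood ratio bounded. *)
pose e := (2 * D)^-1.
have e0 : 0 < e by rewrite invr_gt0; lra.
have eD : e * D = 2^-1 by rewrite /e; field; lra.
have e2 : e <= 2^-1 by rewrite -eD ler_peMr// ltW.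
pose q0 : R := 2^-1; pose q1 := 2^-1 + e / 2.
(* Coordinate likelihood ratio of [contaminated_prob q1] with respect to [contaminated_prob q0]. *)
pose h (i : bool * bool * bool) : R := if i.1.1 then 1 + e else 1 - e.
have h0 i : 0 <= h i by rewrite /h; case: ifP => _; lra.
have q01 : 0 <= q0 <= 1 by rewrite /q0; apply/andP; split; lra.
have q11 : 0 <= q1 <= 1 by rewrite /q1; apply/andP; split; lra.
have noise q : 0 <= q <= 1 ->
    scaled_noise a tau (contaminated_prob q) (contaminated 1)
      (Num.sqrt (1 + q)).
  move=> q_01; have [qge0 _] := andP q_01.
  apply: contaminated_noise => //; [lra|by rewrite sqrtr_gt0; lra|].
  by rewrite expr1n mulr1 sqr_sqrtr//; lra.
have sq q : 0 <= q <= 1 -> 0 < Num.sqrt (1 + q) :> R /\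
    Num.sqrt (1 + q) ^+ 2 = 1 + q.
  by move=> /andP[? _]; rewrite sqrtr_gt0 sqr_sqrtr; lra.
have [sq0 sq0E] := sq _ q01; have [sq1 sq1E] := sq _ q11.
have := HM _ _ _ _ sq0 (noise _ q01) _ (sparse0 s d).
have := HM _ _ _ _ sq1 (noise _ q11) _ (sparse0 s d).
rewrite sq0E sq1E.
set N1 := (fun t => (rho <= _)%R%:R); set N0 := (fun t => (rho <= _)%R%:R).
have -> : contaminated_prob q1 = (fun i => contaminated_prob q0 i * h i).
  apply/funext => -[[b e'] u].
  rewrite /contaminated_prob /outlier_prob /coin /h /q0 /q1 /=.
  by case: b; lra.
rewrite fin_expect_reweight => HM1 HM0.
set L : d.-tuple _ -> R := fun t => \prod_(i <- t) h i.
have w0 i : 0 <= contaminated_prob q0 i by exact: contaminated_prob_ge0.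
have L0 t : 0 <= L t by apply: prodr_ge0 => i _.
(* [L - L^2/4 <= min(1, L)], because [(L/2 - 1)^2 >= 0]. *)
have pointwise t : L t + (- 4^-1) * L t ^+ 2 <= N0 t + L t * N1 t.
  have Lt := L0 t.
  have := @variances_separated _ rho (1 + q0) (1 + q1)
    (T [tuple tnth [tuple 0 | _ < d] i + contaminated 1 (tnth t i) | i < d]).
  have -> : 1 + q1 - (1 + q0) = e / 2 by rewrite /q1 /q0; lra.
  (* The variances differ by [e / 2] and sum to [3 + e / 2 <= 4], while [rho <= e / 8]. *)
  have sep : rho * (1 + q0 + (1 + q1)) <= e / 2.
    apply: (@le_trans _ _ ((16 * D)^-1 * (1 + q0 + (1 + q1)))).
      by rewrite ler_wpM2r// /q0 /q1; lra.
    have -> : (16 * D)^-1 = e / 8 by rewrite /e; field; lra.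
    by rewrite /q0 /q1; nra.
  move=> /(_ _ _ sep) /orP[||h01|h01].
  - by rewrite /q0; lra.
  - by rewrite /q1; lra.
  - rewrite [N0 t](_ : _ = 1); last by rewrite /N0 h01.
    have : 0 <= L t * N1 t by rewrite mulr_ge0// /N1.
    have := sqr_ge0 (L t / 2 - 1); nra.
  - rewrite [N1 t](_ : _ = 1); last by rewrite /N1 h01.
    have : 0 <= N0 t by rewrite /N0.
    have := sqr_ge0 (L t); nra.
have := @fin_expect_le _ _ _ d _ _ w0 pointwise.
rewrite !fin_expectD fin_expectZ.
have -> : fin_expect (contaminated_prob q0) L = 1.
  rewrite fin_expect_prod (_ : \sum_i _ = 1) ?expr1n//.
  rewrite sum_bool3 sum_bool2 /contaminated_prob /outlier_prob /coin /h /q0 /=.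
  by field.
have -> : fin_expect (contaminated_prob q0) (fun t : d.-tuple _ => L t ^+ 2) =
    (1 + e ^+ 2) ^+ d.
  transitivity (fin_expect (contaminated_prob q0)
      (fun t : d.-tuple _ => \prod_(i <- t) h i ^+ 2)).
    by apply: eq_fin_expect => t; rewrite -prodrXl.
  rewrite fin_expect_prod; congr (_ ^+ _).
  rewrite sum_bool3 sum_bool2 /contaminated_prob /outlier_prob /coin /h /q0 /=.
  by field.
(* The second moment is at most 4/3, so the pointwise bound averages to at least [1 - 1/3]; each of
   the two terms, times [k], is at most [M]. *)
have := exprD1_bernoulli_le _ d (sqr_ge0 e).
have -> : d%:R * e ^+ 2 = 4^-1 by rewrite -D2 -exprMn mulrC eD; field.
set E0 := fin_expect _ N0; set E1 := fin_expect _ (fun t => _ * _).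
rewrite -/E1 in HM1; rewrite -/E0 in HM0.
set X := (1 + e ^+ 2) ^+ d => X4 XE.
have : 2 / 3 <= E0 + E1 by lra.
nra.
Qed.

Lemma sparse_bound {R : realType} (a tau : R) (s d : nat)
    (T : d.-tuple R -> R) (rho k M : R) :
  0 < tau -> 2 <= a -> (1 <= s <= d)%N -> 0 <= k ->
  rho <= 2^-1 -> rho <= tau ^+ 2 / 64 * (s%:R / d%:R) `^ (1 - 2 / a) ->
  miss_bound a tau s T rho k M -> k / 4 <= M.
Proof.
move=> tau0 a2 /andP[s1 sd] k0 rho_half rho_le HM.
have s0R : 0 < s%:R :> R by rewrite ltr0n.
have d0R : 0 < d%:R :> R by rewrite ltr0n (leq_trans s1).
(* The expected number of outliers is [d * q = s / 4]. *)
pose q : R := s%:R / (4 * d%:R).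
have q0 : 0 < q by rewrite divr_gt0// mulr_gt0.
have q4E : 4 * q = s%:R / d%:R by rewrite /q; field; lra.
have dqE : d%:R * q = s%:R / 4 by rewrite /q; field; lra.
have sdR : s%:R / d%:R <= 1 :> R by rewrite ler_pdivrMr// mul1r ler_nat.
have q4 : q <= 4^-1 by lra.
have [t [t0 qt tsize]] := outlier_size a tau q tau0 a2 q0 q4.
have q01 : 0 <= q <= 1 by apply/andP; split; lra.
pose v := 1 + q * t ^+ 2.
have v1 : 1 <= v by rewrite lerDl mulr_ge0 ?sqr_ge0// ltW.
have sgv : Num.sqrt v ^+ 2 = v by rewrite sqr_sqrtr//; lra.
have sg0 : 0 < Num.sqrt v by rewrite sqrtr_gt0; lra.
have noise1 : scaled_noise a tau (contaminated_prob q) (contaminated t) (Num.sqrt v).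
  by apply: contaminated_noise => //; lra.
have HM1 := HM _ _ _ _ sg0 noise1 _ (sparse0 s d).
rewrite sgv in HM1.
have HM0 := HM _ _ _ _ ltr01 (rademacher_noise a tau).
pose theta (e : d.-tuple (bool * bool)) := map_tuple (outlier t) e.
pose N (u : R) (y : d.-tuple R) : R := (rho <= `|T y / u - 1|)%R%:R.
have N1 u y : N u y <= 1 by rewrite /N lern1 leq_b1.
pose Y (e : d.-tuple (bool * bool)) (u : d.-tuple bool) :=
  [tuple tnth (theta e) i + sgb (tnth u i) | i < d].
have half0 u : 0 <= coin u :> R by rewrite invr_ge0.
have half1 : \sum_u coin u = 1 :> R by rewrite big_bool /coin /=; lra.
have M0 : 0 <= M.
  apply: le_trans HM1; apply: mulr_ge0 => //; apply: fin_expect_ge0 => // i.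
  exact: contaminated_prob_ge0.
have out0 i : 0 <= outlier_prob q i.
  by rewrite mulr_ge0//; case: ifP => _; lra.
(* Where theta fails to be sparse, the count exceeds s: the bound is trivial. *)
have given e : k * fin_expect coin (fun u => N 1 (Y e u)) <=
    M + k / s%:R * (count fst e)%:R.
  have [es|es] := leqP (count fst e) s.
    have sp : sparse s (theta e).
      rewrite /sparse count_map; apply: leq_trans es; apply: sub_count => -[b x].
      by rewrite /= /outlier /=; case: b => //; rewrite eqxx.
    have := HM0 _ sp; rewrite expr1n => /le_trans; apply.
    by rewrite lerDl mulr_ge0// divr_ge0// ltW.
  apply: (@le_trans _ _ k).
    rewrite ler_piMr// -(@fin_expect_cst _ _ coin d 1 half1).
    by apply: fin_expect_le.
  rewrite -[X in X <= _]add0r lerD// -mulrA ler_peMr// ler_pdivlMl// mulr1 ler_nat.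
  exact: ltnW.
(* Averaging [given] over the random mean turns the count into [s / 4]: Markov's inequality, at cost
   [k / 4]. *)
have mixture : k * fin_expect (contaminated_prob q)
    (fun i : d.-tuple _ => N 1 (Y (map_tuple fst i) (map_tuple snd i))) <=
    M + k / 4.
  rewrite -(@fin_expect_pair _ _ _ (outlier_prob q) coin d (fun e u => N 1 (Y e u))).
  rewrite -fin_expectZ; apply: le_trans (fin_expect_le _ _ _ _ out0 given) _.
  rewrite fin_expectD fin_expectZ fin_expect_cst ?sum_outlier_prob//.
  rewrite fin_expect_count ?sum_outlier_prob//.
  have -> : \sum_(i | i.1) outlier_prob q i = q.
    by rewrite big_mkcond sum_bool2 /outlier_prob /coin /=; lra.
  rewrite dqE (_ : k / s%:R * (s%:R / 4) = k / 4)//; field; lra.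
have qt0 : 0 <= q * t ^+ 2 by rewrite mulr_ge0 ?sqr_ge0// ltW.
(* With [x = q * t ^+ 2] the claim is [2 * rho + rho * x <= x]; each bound on [rho] makes one of the
   two terms at most [x / 2]. *)
have sep : rho * (1 + v) <= v - 1.
  rewrite /v; set x := q * t ^+ 2 in qt0 tsize *.
  move: rho_le tsize; rewrite -q4E; set p := _ `^ _ => rho_le tsize.
  have : rho * x <= x / 2 by rewrite mulrC ler_wpM2l.
  by lra.
(* The same observation is read with variance 1 and a random mean, or with variance [v] and mean 0;
   the estimate misses one of them. *)
have cover (i : d.-tuple (bool * bool * bool)) :
    1 <= N 1 (Y (map_tuple fst i) (map_tuple snd i)) +
      N v [tuple tnth [tuple 0 | _ < d] j + contaminated t (tnth i j) | j < d].
  rewrite (_ : Y _ _ =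
    [tuple tnth [tuple 0 | _ < d] j + contaminated t (tnth i j) | j < d]).
    set y := [tuple _ | _ < _].
    have v0 : 0 < v by lra.
    by case/orP: (variances_separated rho 1 v (T y) ltr01 v0 sep) => h;
      rewrite /N h ?lerDl ?lerDr.
  by apply: eq_from_tnth => j; rewrite !tnth_mktuple !tnth_map add0r.
have := @fin_expect_le _ _ _ d _ _ (fun i => contaminated_prob_ge0 q i q01) cover.
rewrite fin_expectD fin_expect_cst ?sum_contaminated_prob// => total.
move: mixture HM1; rewrite /N.
move: total; rewrite /N.
set E0 := fin_expect _ _; set E1 := fin_expect _ _ => total mix HM1.
(* The misses add up to [k <= (M + k / 4) + M]. *)
have : k <= k * E0 + k * E1 by rewrite -mulrDr ler_peMr.
lra.
Qed.

(** * From miss probabilities to the minimax risk *)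

(** Markov's inequality for a monotone loss: on a miss by at least [rho] the argument of [l] is at
    least [x0], and elsewhere [l] is nonnegative. *)
Lemma risk_miss_bound {R : realType} (l : R -> R) (c a tau x0 rho : R)
    (s d : nat) (T : d.-tuple R -> R) (M : R) :
  (forall x y, 0 <= x -> x <= y -> l x <= l y) ->
  (forall y, 0 <= y -> 0 <= l y) ->
  0 <= x0 -> 0 <= c -> x0 <= c * (phi_pol a s d)^-1 * rho ->
  (forall P sigma theta, noise_class a tau P -> 0 < sigma -> sparse s theta ->
    (risk l c a s T P sigma theta <= M%:E)%E) ->
  miss_bound a tau s T rho (l x0) M.
Proof.
move=> l_nd l0 x00 c0 x0_le risk_le I w z sigma sg0 noise theta sp.
have [w0 _ _ _ _] := noise.
have [P nP riskP] := scaled_noise_risk l c a tau s d w z sigma T l0 c0 sg0 noise.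
have := le_trans (riskP theta) (risk_le P sigma theta nP sg0 sp).
rewrite lee_fin; apply: le_trans; rewrite -fin_expectZ.
have phi0 : 0 <= c * (phi_pol a s d)^-1.
  by rewrite mulr_ge0// invr_ge0 /phi_pol le_max powR_ge0 orbT.
apply: fin_expect_le => // t; case: (leP rho _) => [miss|_].
  rewrite mulr1; apply: l_nd => //; apply: le_trans x0_le _.
  exact: ler_wpM2l.
by rewrite mulr0; apply: l0; exact: mulr_ge0.
Qed.

Theorem theorem6 (R : realType) (tau a : R) (l : R -> R) :
  0 < tau -> 2 <= a -> loss_class l ->
  exists c c' : R, 0 < c /\ 0 < c' /\
    forall s d : nat, (1 <= s <= d)%N ->
      (c'%:E <= minimax_risk l c a tau s d)%E.
Proof.
move=> tau0 a2 [l_nd l00 l0 [x0 [x0_ge0 lx0]]].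
have x00 : 0 < x0.
  by rewrite lt_neqAle x0_ge0 andbT; apply: contraNneq lx0 => <-; apply/eqP.
have k0 : 0 < l x0 by rewrite lt_neqAle eq_sym lx0 l0.
(* The two terms are the constants tolerated by [parametric_bound] and [sparse_bound]. *)
pose delta := Num.min 16^-1 (tau ^+ 2 / 64).
have delta0 : 0 < delta.
  by rewrite lt_min invr_gt0 ltr0n divr_gt0// exprn_gt0.
have delta16 : delta <= 16^-1 by rewrite ge_min lexx.
have delta_tau : delta <= tau ^+ 2 / 64 by rewrite ge_min lexx orbT.
(* With this [c], a miss by [delta * phi] makes the argument of [l] exactly [x0]. *)
exists (x0 / delta), (l x0 / 4).
split; first by rewrite divr_gt0.
split; first by rewrite divr_gt0.
move=> s d sd; have [s1 sd'] := andP sd.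
have d0 : (0 < d)%N by exact: leq_trans sd'.
(* If the worst risk of [T] were below [l x0 / 4], some real [M] below that value would bound all
   its risks; the rest shows [l x0 / 4 <= M]. *)
apply: le_ereal_inf_tmp => _ [T [_ ->]]; rewrite leNgt; apply/negP.
move=> /lte_EFin_exists_le[M supM]; apply/negP; rewrite -leNgt.
pose phi := phi_pol a s d.
have sqd0 : 0 < Num.sqrt (d%:R : R) by rewrite sqrtr_gt0 ltr0n.
have phi0 : 0 < phi by rewrite /phi /phi_pol lt_max invr_gt0 sqd0.
have HM : miss_bound a tau s T (delta * phi) (l x0) M.
  apply: (@risk_miss_bound _ l (x0 / delta)) => //.
  - by rewrite ltW// divr_gt0.
  - rewrite le_eqVlt; apply/orP; left; apply/eqP; rewrite -/phi; field.
    by rewrite !gt_eqF.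
  - move=> P sigma theta nP sg0 sp; apply: le_trans supM.
    by apply: ereal_sup_ubound; exists P, sigma, theta.
(* This keeps [delta * phi] below 1/2 when the sparse term attains the maximum. *)
have ratio1 : (s%:R / d%:R) `^ (1 - 2 / a) <= 1 :> R.
  rewrite -[leRHS](powRr0 (s%:R / d%:R)) ger_powR//.
    by rewrite divr_gt0 ?ltr0n// ler_pdivrMr ?ltr0n// mul1r ler_nat.
  by rewrite subr_ge0 ler_pdivrMr; lra.
have [phiE|phiE] : phi = (Num.sqrt d%:R)^-1 \/ phi = (s%:R / d%:R) `^ (1 - 2 / a).
  by rewrite /phi /phi_pol maxElt; case: ifP => _; [right|left].
- apply: parametric_bound HM => //; [lra|exact: ltW|].
  by rewrite phiE invfM ler_wpM2r// invr_ge0 ltW.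
- apply: sparse_bound HM => //; first exact: ltW.
  + rewrite phiE; set p := _ `^ _ in ratio1 *.
    have p0 : 0 <= p by exact: powR_ge0.
    by rewrite -[leRHS]mulr1; apply: ler_pM => //; lra.
  + by rewrite phiE ler_wpM2r// powR_ge0.
Qed.
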